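(* Let $G=(V,E,W)$ be a road network, $Q_f\subseteq V$ a set of facilities, $m$ a moving object with planar coordinates $P(m)$, $q_f\in Q_f$ a facility, and $k$ a positive integer. Let $d_r=SD(m,q_f)$. If the number of facilities $q'\in Q_f$ with $ED(P(m),P(q'))\le d_r$ (i.e. lying within the closed Euclidean disk centered at $P(m)$ with radius $d_r$) is at most $k$, then $q_f\in kNN(m,Q_f,k)$.
   Context: A road network $G=(V,E,W)$ is an undirected graph with finite vertex set $V$, edge set $E$, and a function $W$ assigning to each edge $e$ a positive weight $w(e)$ representing the distance (length) of the road segment. Each vertex $v\in V$ has two-dimensional coordinates $P(v)\in\mathbb{R}^2$. $Q_f\subseteq V$ is a set of fixed facility points. For $x,y\in V$, $SD(x,y)$ is the shortest path distance in $G$. A moving object $m$ is located on an edge $e_m=(u,v)$ at offset $\mathrm{off}_m\in[0,w(e_m)]$ from endpoint $u$, and $P(m)\in\mathbb{R}^2$ denotes its planar position. Its network distance to a facility $q\in Q_f$ is $$SD(m,q)=\min\bigl(\mathrm{off}_m+SD(u,q),\; w(e_m)-\mathrm{off}_m+SD(v,q)\bigr).$$ $ED$ denotes Euclidean distance in the plane. Standing assumption: Euclidean distance never exceeds network distance, i.e. $ED(P(m),P(q))\le SD(m,q)$ for every facility $q\in Q_f$. For a positive integer $k\le|Q_f|$, $kNN(m,Q_f,k)$ is a set of $k$ facilities closest to $m$ in network distance: a subset $kNN(m,Q_f,k)\subseteq Q_f$ with (1) $|kNN(m,Q_f,k)|=k$ and (2) $SD(m,q')\le SD(m,q'')$ for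 all $q'\in kNN(m,Q_f,k)$ and all $q''\in Q_f\setminus kNN(m,Q_f,k)$. If ties make this set non-unique, one such set is fixed. *)

(* Defs.v *)
From mathcomp Require Import all_boot all_order all_algebra.
From mathcomp Require Import classical_sets reals ereal.

Set Implicit Arguments.
Unset Strict Implicit.
Unset Printing Implicit Defensive.

Import Order.TTheory GRing.Theory Num.Theory.
Local Open Scope ring_scope.

(* An undirected edge is the two-element set of its endpoints; the values of
   [weight] outside [edges] are irrelevant. *)
Record road_network (R : realType) (V : finType) := RoadNetwork {
  edges : {set {set V}};
  weight : {set V} -> R;
  vpos : V -> R * R;
  card_edge : forall e, e \in edges -> #|e| = 2%N;
  weight_gt0 : forall e, e \in edges -> 0 < weight e
}.

Definition adj (R : realType) (V : finType) (G : road_network R V) : rel V :=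
  fun x y => [set x; y] \in edges G.

(* The length of the walk with vertex sequence [x :: p]. *)
Definition walk_length (R : realType) (V : finType) (G : road_network R V)
    (x : V) (p : seq V) : R :=
  \sum_(e <- pairmap (fun a b : V => [set a; b]) x p) weight G e.

(* [G] need not be connected: the distance is [+oo] (the infimum of the empty
   set) when no walk joins [x] to [y]. *)
Definition SD (R : realType) (V : finType) (G : road_network R V)
    (x y : V) : \bar R :=
  ereal_inf [set ((walk_length G x p)%:E)%E |
             p in [set p : seq V | path (adj G) x p /\ last x p = y]]%classic.

Record moving_object (R : realType) (V : finType) (G : road_network R V) :=
  MovingObject {
    obj_u : V;
    obj_v : V;
    obj_edge : [set obj_u; obj_v] \in edges G;
    obj_off : R;
    obj_off_range : 0 <= obj_off <= weight G [set obj_u; obj_v];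
    obj_pos : R * R
  }.

Definition obj_SD (R : realType) (V : finType) (G : road_network R V)
    (m : moving_object G) (q : V) : \bar R :=
  let w := weight G [set obj_u m; obj_v m] in
  Order.min ((obj_off m)%:E + SD G (obj_u m) q)%E
            ((w - obj_off m)%:E + SD G (obj_v m) q)%E.

(* The library's norm on a product is the max norm, hence the explicit root. *)
Definition ED (R : realType) (a b : R * R) : R :=
  Num.sqrt ((a.1 - b.1) ^+ 2 + (a.2 - b.2) ^+ 2).

(* Because of ties there may be several such sets [N]. *)
Definition is_kNN (R : realType) (V : finType) (G : road_network R V)
    (m : moving_object G) (Qf : {set V}) (k : nat) (N : {set V}) : Prop :=
  [/\ N \subset Qf, #|N| = k &
      forall q' q'' : V, q' \in N -> q'' \in Qf :\: N ->
        (obj_SD m q' <= obj_SD m q'')%E].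

(* Main.v *)
(* If [qf] were not among the [k] nearest facilities, each of those would be at
   network distance at most [d_r], hence in the disk, which also contains [qf]:
   it would hold at least [k + 1] facilities. *)
Require Import Defs.
From mathcomp Require Import all_boot all_order all_algebra.
From mathcomp Require Import classical_sets reals ereal.

Set Implicit Arguments.
Unset Strict Implicit.
Unset Printing Implicit Defensive.

Import Order.TTheory GRing.Theory Num.Theory.
Local Open Scope ring_scope.

Theorem lemma5p2 (R : realType) (V : finType) (G : road_network R V)
    (Qf : {set V}) (m : moving_object G)
    (ED_le_SD : forall q : V, q \in Qf ->
       ((ED (obj_pos m) (vpos G q))%:E <= obj_SD m q)%E)
    (qf : V) (qf_in : qf \in Qf)
    (k : nat) (k_gt0 : (0 < k)%N) (k_le : (k <= #|Qf|)%N)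
    (kNN : {set V}) (kNN_spec : is_kNN m Qf k kNN) :
  let d_r := obj_SD m qf in
  (#|[set q' in Qf | ((ED (obj_pos m) (vpos G q'))%:E <= d_r)%E]| <= k)%N ->
  qf \in kNN.
Proof.
case: kNN_spec => sub_Qf card_kNN closest /= card_disk.
apply: contraLR card_disk => qfN; rewrite -ltnNge -card_kNN.
(* By [qfN] the union has [1 + #|kNN|] elements, so inclusion alone gives the strict inequality. *)
suff /subset_leq_card : qf |: kNN \subset
    [set q' in Qf | ((ED (obj_pos m) (vpos G q'))%:E <= obj_SD m qf)%E].
  by rewrite cardsU1 qfN.
apply/fintype.subsetP => q; rewrite !inE => /predU1P[-> | qN].
  (* The radius is the network distance of [qf] itself, which bounds its Euclidean distance. *)
  by rewrite qf_in ED_le_SD.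
have qQ := fintype.subsetP sub_Qf q qN.
(* The network distance of [q] is the middle term; [closest] compares it with the radius because
   [qf] lies in [Qf :\: kNN]. *)
rewrite qQ; apply: le_trans (ED_le_SD q qQ) _.
by apply: closest => //; rewrite inE qfN.
Qed.
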